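(* Let $X\subset\mathbb{R}^n$ be nonempty, compact and convex, let $Y\subset\mathbb{R}^p$, and let $f,g_1,\dots,g_m:\mathbb{R}^n\times\mathbb{R}^p\to\mathbb{R}$ be convex (hence continuous) functions. Consider the convex mixed-integer nonlinear program $$\text{(P)}\qquad \min_{x,y}\ f(x,y)\quad\text{subject to } g_i(x,y)\le 0\ (i=1,\dots,m),\ x\in X,\ y\in Y,$$ and assume that the following Slater constraint qualification holds: for every $y\in Y$ for which there is $x\in X$ with $g_i(x,y)\le 0$ for all $i$, there is $\hat x\in X$ with $g_i(\hat x,y)<0$ for all $i$. Let the data $(x_j,y_j,\alpha_j,\beta_j,\xi_{j,i},\eta_{j,i})$, $j\in T$, and $(x_l,y_l,\xi_{l,i},\eta_{l,i})$, $l\in S$, be chosen as described in the context. Consider the master program $$\text{(MP)}\qquad \min_{x,y,\theta}\ \theta\quad\text{subject to}$$ $$f(x_j,y_j)+\langle\alpha_j,x-x_j\rangle+\langle\beta_j,y-y_j\rangle\le\theta\quad\forall j\in T,$$ $$g_i(x_j,y_j)+\langle\xi_{j,i},x-x_j\rangle+\langle\eta_{j,i},y-y_j\rangle\le 0\quad\forall j\in T,\ i=1,\dots,m,$$ $$g_i(x_l,y_l)+\langle\xi_{l,i},x-x_l\rangle+\langle\eta_{l,i},y-y_l\rangle\le 0\quad\forall l\in S,\ i=1,\dots,m,$$ $$x\in X,\quad y\in Y,\quad \theta\in\mathbb{R}.$$ Then (MP) is equivalent to (P) in the following sense: (P) and (MP) have the same optimal value, and whenever $(\bar x,\bar y)$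 is an optimal solution of (P), the triple $(\bar x,\bar y,\bar\theta)$ with $\bar\theta=f(\bar x,\bar y)$ is an optimal solution of (MP).
   Context: Subdifferential. For a convex function $\varphi:\mathbb{R}^d\to\mathbb{R}$, $\partial\varphi(\bar z)=\{\alpha:\langle\alpha,z-\bar z\rangle\le\varphi(z)-\varphi(\bar z)\ \forall z\}$. For $\phi:\mathbb{R}^n\times\mathbb{R}^p\to\mathbb{R}$ convex, $\partial\phi(\bar x,\bar y)$ is the subdifferential in both variables jointly and $\partial\phi(\cdot,\bar y)(\bar x)$ is the subdifferential at $\bar x$ of $x\mapsto\phi(x,\bar y)$. For $x\in X$, $N(X,x)=\{\gamma\in\mathbb{R}^n:\langle\gamma,z-x\rangle\le 0\ \forall z\in X\}$. $[t]_+=\max\{t,0\}$. The optimal value of a minimization problem is the infimum of the objective over the feasible set ($+\infty$ if the feasible set is empty). Let $\Sigma=\{y\in Y:\exists x\in X,\ g_i(x,y)\le 0\ \forall i\}$. For $y\in Y$, let $P^{y}$ be the problem of minimizing $f(x,y)$ over $x\in X$ with $g_i(x,y)\le0$ for all $i$; it is feasible if and only if $y\in\Sigma$. Feasible data. The points $y_j$, $j\in T$, enumerate $\Sigma$. For each $j\in T$, $x_j$ is a chosen optimal solution of $P^{y_j}$, $I(x_j)=\{i:g_i(x_j,y_j)=0\}$, and $\alpha_j,\beta_j,\xi_{j,i},\eta_{j,i}$ ($i=1,\dots,m$) are chosen such that $(\alpha_j,\beta_j)\in\partial f(x_j,y_j)$, $(\xi_{j,i},\eta_{j,i})\in\partial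 g_i(x_j,y_j)$ for all $i$, and, for some $\lambda_{j,i}\ge 0$, $$-\alpha_j-\sum_{i\in I(x_j)}\lambda_{j,i}\xi_{j,i}\in N(X,x_j).$$ Infeasible data. The points $y_l$, $l\in S$, enumerate $Y\setminus\Sigma$. For each $l\in S$, $J_l\subset\{1,\dots,m\}$ is a chosen subset for which there is $\hat x\in X$ with $g_i(\hat x,y_l)<0$ for all $i\in J_l$; $J_l^{\perp}=\{1,\dots,m\}\setminus J_l$; and $x_l$ is a chosen optimal solution of $$F^{y_l}:\quad\min_x\ \sum_{i\in J_l^\perp}[g_i(x,y_l)]_+\quad\text{subject to } g_i(x,y_l)\le 0\ (i\in J_l),\ x\in X.$$ Put $J_l^1=\{i\in J_l^\perp:g_i(x_l,y_l)=0\}$, $J_l^2=\{i\in J_l^\perp:g_i(x_l,y_l)>0\}$, $J_l^3=\{i\in J_l^\perp:g_i(x_l,y_l)<0\}$. The vectors $\xi_{l,i},\eta_{l,i}$ ($i=1,\dots,m$) are chosen such that $(\xi_{l,i},\eta_{l,i})\in\partial g_i(x_l,y_l)$ for all $i$ and $$-\sum_{i=1}^m\lambda_{l,i}\xi_{l,i}\in N(X,x_l)$$ for some multipliers with $\lambda_{l,i}\ge0$ and $\lambda_{l,i}g_i(x_l,y_l)=0$ for $i\in J_l$, $\lambda_{l,i}\in[0,1]$ for $i\in J_l^1$, $\lambda_{l,i}=1$ for $i\in J_l^2$, and $\lambda_{l,i}=0$ for $i\in J_l^3$. Such choices exist (in the feasible case, under the Slater constraint qualification that for every $y\in\Sigma$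 there is $\hat x\in X$ with $g_i(\hat x,y)<0$ for all $i$). *)

(* Defs.v *)
From HB Require Import structures.
From mathcomp Require Export all_boot all_order all_algebra.
From mathcomp Require Export all_classical all_reals all_analysis.

Set Implicit Arguments.
Unset Strict Implicit.
Unset Printing Implicit Defensive.

Export Order.TTheory GRing.Theory Num.Theory.
Export numFieldNormedType.Exports.

Local Open Scope classical_set_scope.
Local Open Scope ring_scope.

Definition dotv (R : realType) (d : nat) (u v : 'rV[R]_d) : R :=
  \sum_(i < d) u 0 i * v 0 i.

(* ereal_inf set0 = +oo, the value of an infeasible problem. *)
Definition optimal_value (R : realType) (Z : Type) (F : set Z) (obj : Z -> R)
    : \bar R :=
  ereal_inf [set (obj z)%:E | z in F].

Definition optimal_solution (R : realType) (Z : Type) (F : set Z)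
    (obj : Z -> R) (z : Z) : Prop :=
  F z /\ forall w, F w -> obj z <= obj w.

Definition subdifferential (R : realType) (n p : nat)
    (phi : 'rV[R]_n * 'rV[R]_p -> R) (zb : 'rV[R]_n * 'rV[R]_p)
    : set ('rV[R]_n * 'rV[R]_p) :=
  [set s | forall z : 'rV[R]_n * 'rV[R]_p,
    dotv s.1 (z.1 - zb.1) + dotv s.2 (z.2 - zb.2) <= phi z - phi zb].

Definition normal_cone (R : realType) (n : nat) (X : set 'rV[R]_n)
    (x : 'rV[R]_n) : set 'rV[R]_n :=
  [set c | forall z, X z -> dotv c (z - x) <= 0].

Section Problem.
Context {R : realType} {n p m : nat}.
Variables (X : set 'rV[R]_n) (Y : set 'rV[R]_p).
Variables (f : 'rV[R]_n * 'rV[R]_p -> R) (g : 'I_m -> 'rV[R]_n * 'rV[R]_p -> R).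

Definition P_feasible : set ('rV[R]_n * 'rV[R]_p) :=
  [set z | [/\ forall i, g i z <= 0, X z.1 & Y z.2]].

Definition Sigma : set 'rV[R]_p :=
  [set y | Y y /\ exists2 x, X x & forall i, g i (x, y) <= 0].

Definition slater : Prop :=
  forall y, Y y -> (exists2 x, X x & forall i, g i (x, y) <= 0) ->
    exists2 xh, X xh & forall i, g i (xh, y) < 0.

Definition Py_feasible (y : 'rV[R]_p) : set 'rV[R]_n :=
  [set x | X x /\ forall i, g i (x, y) <= 0].

Definition active (x : 'rV[R]_n) (y : 'rV[R]_p) : {set 'I_m} :=
  [set i | g i (x, y) == 0]%SET.

Definition feasible_datum (x : 'rV[R]_n) (y : 'rV[R]_p)
    (alpha : 'rV[R]_n) (beta : 'rV[R]_p)
    (xi : 'I_m -> 'rV[R]_n) (eta : 'I_m -> 'rV[R]_p) : Prop :=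
  [/\ optimal_solution (Py_feasible y) (fun x' => f (x', y)) x,
      subdifferential f (x, y) (alpha, beta),
      forall i, subdifferential (g i) (x, y) (xi i, eta i) &
      exists2 lambda : 'I_m -> R,
        forall i, i \in active x y -> 0 <= lambda i &
        normal_cone X x (- alpha - \sum_(i in active x y) lambda i *: xi i)].

Definition Fy_feasible (J : {set 'I_m}) (y : 'rV[R]_p) : set 'rV[R]_n :=
  [set x | (forall i, i \in J -> g i (x, y) <= 0) /\ X x].

Definition Fy_objective (J : {set 'I_m}) (y : 'rV[R]_p) (x : 'rV[R]_n) : R :=
  \sum_(i in ~: J) Num.max (g i (x, y)) 0.

(* The three implications are the cases J^1, J^2, J^3 of the index partition
   of the complement of J by the sign of g_i(x, y). *)
Definition infeasible_multipliers (J : {set 'I_m}) (x : 'rV[R]_n)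
    (y : 'rV[R]_p) (lambda : 'I_m -> R) : Prop :=
  (forall i, i \in J -> 0 <= lambda i /\ lambda i * g i (x, y) = 0) /\
  (forall i, i \in ~: J ->
    [/\ g i (x, y) = 0 -> 0 <= lambda i <= 1,
        0 < g i (x, y) -> lambda i = 1 &
        g i (x, y) < 0 -> lambda i = 0]).

Definition infeasible_datum (J : {set 'I_m}) (x : 'rV[R]_n) (y : 'rV[R]_p)
    (xi : 'I_m -> 'rV[R]_n) (eta : 'I_m -> 'rV[R]_p) : Prop :=
  [/\ exists2 xh, X xh & forall i, i \in J -> g i (xh, y) < 0,
      optimal_solution (Fy_feasible J y) (Fy_objective J y) x,
      forall i, subdifferential (g i) (x, y) (xi i, eta i) &
      exists2 lambda : 'I_m -> R, infeasible_multipliers J x y lambda &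
        normal_cone X x (- \sum_(i < m) lambda i *: xi i)].

Definition MP_feasible (T S : Type)
    (xT : T -> 'rV[R]_n) (yT : T -> 'rV[R]_p)
    (alpha : T -> 'rV[R]_n) (beta : T -> 'rV[R]_p)
    (xiT : T -> 'I_m -> 'rV[R]_n) (etaT : T -> 'I_m -> 'rV[R]_p)
    (xS : S -> 'rV[R]_n) (yS : S -> 'rV[R]_p)
    (xiS : S -> 'I_m -> 'rV[R]_n) (etaS : S -> 'I_m -> 'rV[R]_p)
    : set ('rV[R]_n * 'rV[R]_p * R) :=
  [set w | let: (x, y, theta) := w in
    [/\ forall j, f (xT j, yT j) + dotv (alpha j) (x - xT j)
                  + dotv (beta j) (y - yT j) <= theta,
        forall j i, g i (xT j, yT j) + dotv (xiT j i) (x - xT j)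
                    + dotv (etaT j i) (y - yT j) <= 0,
        forall l i, g i (xS l, yS l) + dotv (xiS l i) (x - xS l)
                    + dotv (etaS l i) (y - yS l) <= 0,
        X x & Y y]].

End Problem.

(* Main.v *)
(** Subgradient inequalities show that the linearized constraints of (MP) hold
    at every feasible point of (P).  Conversely, weighting the cuts at a datum
    by its KKT multipliers cancels the directional terms up to an element of the
    normal cone: the cuts at an infeasible [y_l] exclude [y = y_l] altogether,
    and those at a feasible [y_j] force [theta >= f(x_j, y_j)] when [y = y_j]. *)
Require Import Defs.
From mathcomp Require Import lra.

Set Implicit Arguments.
Unset Strict Implicit.
Unset Printing Implicit Defensive.

Local Open Scope classical_set_scope.
Local Open Scope ring_scope.

Section DotProduct.
Context {R : realType} {d : nat}.
Implicit Types u v w : 'rV[R]_d.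

Lemma dotv0r u : dotv u 0 = 0.
Proof. by rewrite /dotv big1 // => i _; rewrite mxE mulr0. Qed.

Lemma dotvDl u v w : dotv (u + v) w = dotv u w + dotv v w.
Proof.
by rewrite /dotv -big_split /=; apply: eq_bigr => i _; rewrite mxE mulrDl.
Qed.

Lemma dotvNl u w : dotv (- u) w = - dotv u w.
Proof. by rewrite /dotv -sumrN; apply: eq_bigr => i _; rewrite mxE mulNr. Qed.

Lemma dotvZl a u w : dotv (a *: u) w = a * dotv u w.
Proof.
by rewrite /dotv mulr_sumr; apply: eq_bigr => i _; rewrite mxE mulrA.
Qed.

Lemma dotv_suml (I : finType) (A : pred I) (a : I -> R) (u : I -> 'rV[R]_d) w :
  dotv (\sum_(i | A i) a i *: u i) w = \sum_(i | A i) a i * dotv (u i) w.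
Proof.
rewrite [RHS](eq_bigr (fun i => dotv (a i *: u i) w)); last first.
  by move=> i _; rewrite dotvZl.
apply: (big_morph (fun v => dotv v w)) => [u1 u2|]; first exact: dotvDl.
by rewrite /dotv big1 // => i _; rewrite mxE mul0r.
Qed.

End DotProduct.

(** Mutual domination of objective values makes each infimum a lower bound for the other. Attainment
    plays no part, so infeasible problems, both of value [+oo], are covered. *)
Lemma optimal_value_eq (R : realType) (Z W : Type) (F : set Z) (G : set W)
    (a : Z -> R) (b : W -> R) :
  (forall z, F z -> exists2 w, G w & b w <= a z) ->
  (forall w, G w -> exists2 z, F z & a z <= b w) ->
  optimal_value F a = optimal_value G b.
Proof.
move=> FG GF; apply/eqP; rewrite eq_le; apply/andP; split;
  apply/ereal_infP => _ [z zP <-]; apply: ge_ereal_inf.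
  have [w wP le_wz] := GF z zP.
  by exists (a w)%:E; [exists w | rewrite lee_fin].
have [w wP le_wz] := FG z zP.
by exists (b w)%:E; [exists w | rewrite lee_fin].
Qed.

Lemma subgradient_cut (R : realType) (n p : nat)
    (phi : 'rV[R]_n * 'rV[R]_p -> R) (x0 x s : 'rV[R]_n) (y0 y t : 'rV[R]_p) :
  subdifferential phi (x0, y0) (s, t) ->
  phi (x0, y0) + dotv s (x - x0) + dotv t (y - y0) <= phi (x, y).
Proof. by move=> /(_ (x, y)) /=; lra. Qed.

Section Data.
Context {R : realType} {n p m : nat}.
Variable X : set 'rV[R]_n.
Variables (f : 'rV[R]_n * 'rV[R]_p -> R) (g : 'I_m -> 'rV[R]_n * 'rV[R]_p -> R).

(** Pairing the KKT vector with [x - x0] bounds [dotv alpha (x - x0)] below by minus the weighted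
    sum of the [dotv (xi i) (x - x0)] over active [i]. There [g i (x0, y0) = 0], so the cut says
    that each of these products is nonpositive. *)
Lemma feasible_datum_cut x0 y0 alpha beta xi eta x :
  feasible_datum X f g x0 y0 alpha beta xi eta -> X x ->
  (forall i, g i (x0, y0) + dotv (xi i) (x - x0) <= 0) ->
  0 <= dotv alpha (x - x0).
Proof.
move=> [_ _ _ [lambda lambda_ge0 normal]] Xx cut.
have := normal x Xx; rewrite dotvDl !dotvNl dotv_suml.
suff : \sum_(i in active g x0 y0) lambda i * dotv (xi i) (x - x0) <= 0 by lra.
apply: sumr_le0 => i iA; rewrite mulr_ge0_le0 ?lambda_ge0 //.
by move: iA (cut i); rewrite inE => /eqP ->; rewrite add0r.
Qed.

Lemma infeasible_multiplier_ge0 (J : {set 'I_m}) x y lambda i :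
  infeasible_multipliers g J x y lambda -> 0 <= lambda i.
Proof.
move=> [inJ notJ]; have [iJ|iJ] := boolP (i \in J); first by have [] := inJ i iJ.
have [|eq0 pos neg] := notJ i; first by rewrite inE.
have [/neg ->//|/pos ->|/eq0 /andP[]//] := ltgtP (g i (x, y)) 0.
exact: ler01.
Qed.

(** On [J] both sides vanish, by complementarity and feasibility. Off [J] the multiplier is a
    subgradient of the positive part at [g i (x, y)], which gives equality. *)
Lemma infeasible_multiplierM (J : {set 'I_m}) x y lambda i :
  infeasible_multipliers g J x y lambda -> (i \in J -> g i (x, y) <= 0) ->
  lambda i * g i (x, y) = Num.max (g i (x, y)) 0.
Proof.
move=> [inJ notJ] gJ; have [iJ|iJ] := boolP (i \in J).
  by have [_ ->] := inJ i iJ; rewrite max_r ?gJ.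
have [|_ pos neg] := notJ i; first by rewrite inE.
have [/[dup] /neg -> ?|/[dup] /pos -> ?|->] := ltgtP (g i (x, y)) 0.
- by rewrite mul0r.
- by rewrite mul1r.
- by rewrite mulr0.
Qed.

(** The witness is [x0] itself: a point [x] of [X] satisfying the cuts would force the total
    constraint violation at [x0] to be zero. *)
Lemma infeasible_datum_cut (J : {set 'I_m}) x0 y0 xi eta x :
  infeasible_datum X g J x0 y0 xi eta -> X x ->
  (forall i, g i (x0, y0) + dotv (xi i) (x - x0) <= 0) ->
  exists2 x', X x' & forall i, g i (x', y0) <= 0.
Proof.
move=> [_ [[gJ Xx0] _] _ [lambda mult normal]] Xx cut; exists x0 => // i.
have sum_le0 : \sum_(k < m) Num.max (g k (x0, y0)) 0 <= 0.
  have : \sum_(k < m) lambda k * (g k (x0, y0) + dotv (xi k) (x - x0)) <= 0.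
    apply: sumr_le0 => k _; rewrite mulr_ge0_le0 //.
    exact: infeasible_multiplier_ge0 mult.
  under eq_bigr do rewrite mulrDr (infeasible_multiplierM mult (@gJ _)).
  (* The normal cone makes the weighted directional part nonnegative, so the sum of positive parts
     is at most the weighted sum of the cuts. *)
  by have := normal x Xx; rewrite big_split dotvNl dotv_suml /=; lra.
apply: le_trans sum_le0; rewrite (bigD1 i) //=.
apply: le_trans (_ : Num.max (g i (x0, y0)) 0 <= _); first by rewrite le_max lexx.
by rewrite lerDl sumr_ge0 // => k _; rewrite le_max lexx orbT.
Qed.

End Data.

Theorem theorem3p5 (R : realType) (n p m : nat)
  (X : set 'rV[R]_n) (Y : set 'rV[R]_p)
  (f : 'rV[R]_n * 'rV[R]_p -> R) (g : 'I_m -> 'rV[R]_n * 'rV[R]_p -> R)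
  (X_neq0 : X !=set0) (X_compact : compact X)
  (X_convex : convex_set (M := 'rV[R]_n) X)
  (f_convex : convex_function (E := ('rV[R]_n * 'rV[R]_p)%type) setT f)
  (g_convex : forall i : 'I_m,
     convex_function (E := ('rV[R]_n * 'rV[R]_p)%type) setT (g i))
  (slaterCQ : slater X Y g)
  (T S : Type)
  (xT : T -> 'rV[R]_n) (yT : T -> 'rV[R]_p)
  (alpha : T -> 'rV[R]_n) (beta : T -> 'rV[R]_p)
  (xiT : T -> 'I_m -> 'rV[R]_n) (etaT : T -> 'I_m -> 'rV[R]_p)
  (yT_enum : range yT = Sigma X Y g)
  (feasible_data : forall j : T,
     feasible_datum X f g (xT j) (yT j) (alpha j) (beta j) (xiT j) (etaT j))
  (J : S -> {set 'I_m})
  (xS : S -> 'rV[R]_n) (yS : S -> 'rV[R]_p)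
  (xiS : S -> 'I_m -> 'rV[R]_n) (etaS : S -> 'I_m -> 'rV[R]_p)
  (yS_enum : range yS = Y `\` Sigma X Y g)
  (infeasible_data : forall l : S,
     infeasible_datum X g (J l) (xS l) (yS l) (xiS l) (etaS l)) :
  let P := P_feasible X Y g in
  let MP := MP_feasible X Y f g xT yT alpha beta xiT etaT xS yS xiS etaS in
  let obj_MP := fun w : 'rV[R]_n * 'rV[R]_p * R => w.2 in
  optimal_value P f = optimal_value MP obj_MP /\
  (forall (xb : 'rV[R]_n) (yb : 'rV[R]_p),
     optimal_solution P f (xb, yb) ->
     optimal_solution MP obj_MP (xb, yb, f (xb, yb))).
Proof.
move=> P MP obj_MP.
have P_MP x y : P (x, y) -> MP (x, y, f (x, y)).
  move=> [/= g_le0 Xx Yy]; split => // [j|j i|l i].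
  - by have [_ fj _ _] := feasible_data j; exact: subgradient_cut.
  - have [_ _ gj _] := feasible_data j.
    exact: le_trans (subgradient_cut _ _ (gj i)) (g_le0 i).
  - have [_ _ gl _] := infeasible_data l.
    exact: le_trans (subgradient_cut _ _ (gl i)) (g_le0 i).
(* The point [(x, y)] may violate the nonlinear constraints; [z] keeps [y] but replaces [x] by the
   stored minimizer for [y]. *)
have MP_P w : MP w -> exists2 z, P z & f z <= obj_MP w.
  case: w => -[x y] theta [cutf cutT cutS Xx Yy].
  have [Sy|nSy] := pselect (Sigma X Y g y).
    have [j _ yj] : range yT y by rewrite yT_enum.
    have [[[Xxj gxj] _] _ _ _] := feasible_data j.
    exists (xT j, yT j); first by split; rewrite //= yj.
    have := cutf j; rewrite /obj_MP /= -yj subrr dotv0r addr0.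
    have : 0 <= dotv (alpha j) (x - xT j).
      apply: feasible_datum_cut (feasible_data j) Xx _ => i.
      by have := cutT j i; rewrite -yj subrr dotv0r addr0.
    by lra.
  have [l _ yl] : range yS y by rewrite yS_enum.
  (* The cuts at [yS l] would place [y] in [Sigma], a contradiction. *)
  case: nSy; split=> //; rewrite -yl.
  apply: infeasible_datum_cut (infeasible_data l) Xx _ => i.
  by have := cutS l i; rewrite -yl subrr dotv0r addr0.
split.
  apply: optimal_value_eq MP_P => -[x y] Pxy.
  by exists (x, y, f (x, y)); [exact: P_MP | exact: lexx].
move=> xb yb [Pb opt]; split; first exact: P_MP.
(* The optimal value of (P) is at most [f z], hence at most the objective at [w]. *)
by move=> w /MP_P[z /opt]; exact: le_trans.
Qed.
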